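(* Let $t<n/2$ and let $V$ be a value domain. The following two-round protocol solves the $t$-MAd-Authenticated-Byzantine-SM task on $n$ processors against a mobile authenticated Byzantine $t$-MAd adversary. Processor $p_i$ has input $x(i)\in V$. (1) Every $p_i$ sends $x(i)$ to every $p_j$, who denotes the received value $v(i)_j$ (set to a fixed default value of $V$ if nothing was received), and lets $\vec v_j=(v(1)_j,\dots,v(n)_j)$. (2) Every $p_i$ sends $\vec v_i$ to every $p_j$, who denotes the received vector $\vec v_{i\to j}=(v(1)_{i\to j},\dots,v(n)_{i\to j})$, where $\vec v_{i\to j}:=\bot^n$ if what was received is not an element of $V^n$. (3) For every $\ell\in[n]$, $p_j$ sets $y(\ell)_j:=b$ if for some $b\in V$ and some set $I\subseteq[n]$ with $|I|\ge n-t$ we have $v(\ell)_{i\to j}=b$ for all $i\in I$ and $v(\ell)_{i\to j}=\bot$ for all $i\in[n]\setminus I$; otherwise $y(\ell)_j:=\bot$. $p_j$ outputs $\vec y_j=(y(1)_j,\dots,y(n)_j)$.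
   Context: System: $n$ processors run a synchronous round-based protocol; each round every processor sends a (possibly different) message to every processor over dedicated point-to-point channels whose receiver knows the sender identity; messages of round $\rho$ are delivered by the start of round $\rho+1$. A message adversary (MAd) sees all messages and may delete or arbitrarily replace outgoing messages, in a given round, of the processors it corrupts in that round; it never alters internal states, inputs, outputs or incoming messages. Authentication constraint: every message has the form $(p_i,\rho,m)$, and for every message $(p,\rho,m)$ sent in the protocol and every $(p',\rho',m')$ with $\rho'\le\rho$ encoded as a substring of $m$, either $p'$ was corrupted in round $\rho'$ or $p'$ was uncorrupted in round $\rho'$ and actually sent $(p',\rho',m')$ (so claims about messages of uncorrupted (processor, round) pairs cannot be forged, apart from pretending a message was not received). A mobile $t$-MAd adversary corrupts at most $t$ processors in each round, possibly a different set each round. The $t$-MAd-Authenticated-Byzantine-SM task: each $p_i$ has input $x(i)\in V$ and outputs $\vec y_i=(y(1)_i,\dots,y(n)_i)$ with each $y(j)_i\in V\cup\{\bot\}$ such that (a) there is $Ind\subseteq[n]$ with $|Ind|\ge n-t$ such that $y(j)_i=x(j)$ for all $j\in Ind$ and all $i\in[n]$; (b) for all $i,j,\ell$, if $y(\ell)_i\ne\bot$ and $y(\ell)_j\ne\bot$ then $y(\ell)_i=y(\ell)_j$. These conditions apply to all processors, corrupted or not.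
   Formalization: In round 2 each entry v(l)_i is sent as the authenticated message (p_l,1,v(l)_i), so a corrupted relay cannot enter a false value or the default for an uncorrupted p_l; only silence or a malformed vector pretends non-receipt. With bare vectors in V^n the claim fails. *)

(* Defs.v *)
From HB Require Import structures.
From Stdlib Require List.
From mathcomp Require Import all_boot.
From mathcomp Require Import boolp.

Set Implicit Arguments.
Unset Strict Implicit.
Unset Printing Implicit Defensive.

(* Classical partial choice: some element satisfying P, if there is one. *)
Definition some_such (A : Type) (P : A -> Prop) : option A :=
  match pselect (exists a, P a) with
  | left h => Some (projT1 (cid h))
  | right _ => None
  end.

(* Message contents. [Signed p r m] is the message (p, r, m), occurring as a
   part of another content; [Seq] also serves to form malformed contents
   (for instance [Seq [::]]). Rounds are numbered from 0. *)
Inductive content (n : nat) (V : Type) : Type :=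
| Val of V
| Signed of 'I_n & nat & content n V
| Seq of seq (content n V).

Arguments Val {n V}.
Arguments Signed {n V}.
Arguments Seq {n V}.

Inductive substring (n : nat) (V : Type) (c : content n V) :
    content n V -> Prop :=
| substring_refl : substring c c
| substring_signed p r m : substring c m -> substring c (Signed p r m)
| substring_seq s d : List.In d s -> substring c d -> substring c (Seq s).

Record protocol (n : nat) (V O : Type) := Protocol {
  state : Type;
  rounds : nat;
  init : 'I_n -> V -> state;
  (* [send r i s j] is the content that i, in state s, sends to j in round r *)
  send : nat -> 'I_n -> state -> 'I_n -> content n V;
  (* [receive r j s m]: j, in state s, gets [m i] from i; [None] is silence *)
  receive : nat -> 'I_n -> state -> ('I_n -> option (content n V)) -> state;
  output : 'I_n -> state -> O
}.

(* [d r i j] is what the channel from i to j carries in round r after the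
   adversary has acted: [Some m] is the message (i, r, m), [None] a deleted
   message. *)
Definition deliveries (n : nat) (V : Type) :=
  nat -> 'I_n -> 'I_n -> option (content n V).

(* State at the start of round r. Corrupted processors also follow the
   protocol: the adversary acts on outgoing messages only. *)
Fixpoint state_at (n : nat) (V O : Type) (P : protocol n V O)
    (x : 'I_n -> V) (d : deliveries n V) (r : nat) (j : 'I_n) : state P :=
  if r is r'.+1 then
    receive r' j (state_at P x d r' j) (fun i => d r' i j)
  else init P j (x j).

Definition authenticated (n : nat) (V : Type) (R : nat)
    (corrupted : nat -> {set 'I_n}) (d : deliveries n V) : Prop :=
  forall r i j m, r < R -> d r i j = Some m ->
  forall p' r' m', r' <= r -> substring (Signed p' r' m') m ->
    p' \in corrupted r' \/
    (p' \notin corrupted r' /\ exists k, d r' p' k = Some m').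

(* Protocols are deterministic, so quantifying over all [corrupted] and [d]
   accounts for adaptive adversaries that see every message. *)
Definition mobile_auth_execution (n : nat) (V O : Type) (t : nat)
    (P : protocol n V O) (x : 'I_n -> V)
    (corrupted : nat -> {set 'I_n}) (d : deliveries n V) : Prop :=
  [/\ forall r, r < rounds P -> #|corrupted r| <= t,
      forall r i j, r < rounds P -> i \notin corrupted r ->
        d r i j = Some (send r i (state_at P x d r i) j)
    & authenticated (rounds P) corrupted d].

Definition solves (n : nat) (V O : Type) (t : nat) (P : protocol n V O)
    (task : ('I_n -> V) -> ('I_n -> O) -> Prop) : Prop :=
  forall x corrupted d, mobile_auth_execution t P x corrupted d ->
    task x (fun i => output i (state_at P x d (rounds P) i)).

(* [y i j] is y(j)_i, and [None] is bottom. *)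
Definition byzantine_SM (n : nat) (V : Type) (t : nat)
    (x : 'I_n -> V) (y : 'I_n -> 'I_n -> option V) : Prop :=
  (exists Ind : {set 'I_n}, n - t <= #|Ind| /\
     forall j, j \in Ind -> forall i, y i j = Some (x j)) /\
  (forall i j l, y i l <> None -> y j l <> None -> y i l = y j l).

(* A vector of values is relayed as the tuple of round-0 messages
   (p_l, 0, v l), so that each entry is a claim subject to authentication. *)
Definition encode (n : nat) (V : Type) (v : {ffun 'I_n -> V}) : content n V :=
  Seq [seq Signed l 0 (Val (v l)) | l <- enum 'I_n].

(* Contents that are not values are treated as if nothing was received. *)
Definition received_value (n : nat) (V : Type) (v0 : V)
    (m : option (content n V)) : V :=
  if m is Some (Val b) then b else v0.

Definition received_vector (n : nat) (V : Type)
    (m : option (content n V)) : 'I_n -> option V :=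
  if some_such (fun v : {ffun 'I_n -> V} => m = Some (encode v)) is Some v
  then fun l => Some (v l) else fun=> None.

(* [w i] is v(l)_{i -> j}, for fixed l and j. At most one b qualifies when
   t < n. *)
Definition decide (n : nat) (V : Type) (t : nat) (w : 'I_n -> option V) :
    option V :=
  some_such (fun b => exists I : {set 'I_n},
    [/\ n - t <= #|I|,
        forall i, i \in I -> w i = Some b
      & forall i, i \notin I -> w i = None]).

Inductive sm_state (n : nat) (V : Type) : Type :=
| Input of V
| Values of {ffun 'I_n -> V}
| Output of {ffun 'I_n -> option V}.

Arguments Input {n V}.
Arguments Values {n V}.
Arguments Output {n V}.

(* The state is [Input] at the start of round 0, [Values] at the start of
   round 1 and [Output] at the end; the remaining cases are unreachable. *)
Definition sm_send (n : nat) (V : Type) (r : nat) (i : 'I_n)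
    (s : sm_state n V) (j : 'I_n) : content n V :=
  match s with
  | Input a => Val a
  | Values v => encode v
  | Output _ => Seq [::]
  end.

Definition sm_receive (n : nat) (V : Type) (t : nat) (v0 : V) (r : nat)
    (j : 'I_n) (s : sm_state n V) (m : 'I_n -> option (content n V)) :
    sm_state n V :=
  match s with
  | Input _ => Values [ffun i => received_value v0 (m i)]
  | Values _ =>
      Output [ffun l => decide t (fun i => received_vector (m i) l)]
  | Output y => Output y
  end.

Definition sm_output (n : nat) (V : Type) (i : 'I_n) (s : sm_state n V) :
    'I_n -> option V :=
  if s is Output y then y else fun=> None.

Definition sm_protocol (n : nat) (V : Type) (t : nat) (v0 : V) :
    protocol n V ('I_n -> option V) :=
  @Protocol n V ('I_n -> option V) (sm_state n V) 2
    (fun _ a => Input a) (@sm_send n V) (@sm_receive n V t v0) (@sm_output n V).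

(* Main.v *)
Require Import Defs.
From HB Require Import structures.
From mathcomp Require Import all_boot.
From mathcomp Require Import boolp.

(** A processor uncorrupted in round 1 relays the same non-bottom value to
everybody, so its claim about l belongs to every set I that justifies a
decision on l; as there is such a processor, all decisions on l agree. If l is
uncorrupted in round 0, then authentication forces a relayer corrupted in
round 1 to report either x(l) or bottom, and everybody decides x(l). *)

Lemma some_suchP {A : Type} {P : A -> Prop} {a : A} :
  some_such P = Some a -> P a.
Proof. by rewrite /some_such; case: pselect => // h [<-]; case: (cid h). Qed.

Lemma some_such_unique (A : Type) (P : A -> Prop) (a : A) :
  P a -> (forall b, P b -> b = a) -> some_such P = Some a.
Proof.
move=> Pa uniqP; rewrite /some_such; case: pselect => [h|[]]; last by exists a.
by congr Some; apply: uniqP; case: (cid h).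
Qed.

Lemma encode_inj (n : nat) (V : Type) : injective (@encode n V).
Proof.
move=> v w [] /eq_in_map eq_vw; apply/ffunP => l.
by have [] := eq_vw l (mem_enum _ _).
Qed.

Lemma received_vector_encode (n : nat) (V : Type) (v : {ffun 'I_n -> V})
    (l : 'I_n) :
  received_vector (Some (encode v)) l = Some (v l).
Proof.
rewrite /received_vector (some_such_unique _ _ v) // => w [].
by move=> eq_vw; apply: (@encode_inj n V); rewrite /encode eq_vw.
Qed.

Lemma received_vectorP {n : nat} {V : Type} {m : option (content n V)}
    {l : 'I_n} {b : V} :
  received_vector m l = Some b ->
  exists2 v : {ffun 'I_n -> V}, m = Some (encode v) & v l = b.
Proof.
rewrite /received_vector; case E: some_such => [v|] // [vl].
by exists v => //; apply: some_suchP E.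
Qed.

(** This exposes each entry of a relayed vector to the authentication constraint, as a claim about
    round 0. *)
Lemma substring_encode (n : nat) (V : Type) (v : {ffun 'I_n -> V})
    (l : 'I_n) :
  substring (Signed l 0 (Val (v l))) (encode v).
Proof.
apply: (@substring_seq _ _ _ _ (Signed l 0 (Val (v l)))); last by constructor.
apply: (List.in_map (fun k => Signed k 0 (Val (v k)))).
(* Boolean membership in [enum 'I_n] becomes [List.In] by induction. *)
elim: (enum 'I_n) (mem_enum 'I_n l) => //= k s IHs.
by rewrite inE => /predU1P[->|/IHs]; [left | right].
Qed.

(** Entries outside a justifying set are bottom, so such a set contains every [i] with a non-bottom
    entry. *)
Lemma decideP (n t : nat) (V : Type) (w : 'I_n -> option V) (b : V)
    (i : 'I_n) :
  decide t w = Some b -> w i <> None -> w i = Some b.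
Proof.
move=> /some_suchP[I [_ wI wNI]] wi.
by case: (boolP (i \in I)) => [/wI | /wNI].
Qed.

Lemma decide_unanimous (n t : nat) (V : Type) (w : 'I_n -> option V) (b : V)
    (U : {set 'I_n}) :
  t < n -> n - t <= #|U| -> (forall i, i \in U -> w i = Some b) ->
  (forall i c, w i = Some c -> c = b) -> decide t w = Some b.
Proof.
move=> lt_tn cardU wU w_b; apply: some_such_unique.
  (* The whole support of [w] is taken, not [U]: relayers outside [U] may also report [b]. *)
  exists [set i | isSome (w i)]; split.
  - apply: leq_trans cardU _; apply/subset_leq_card/subsetP => i /wU wi.
    by rewrite inE wi.
  - by move=> i; rewrite inE; case E: (w i) => [c|] // _; rewrite (w_b i c).
  - by move=> i; rewrite inE; case: (w i).
move=> c [I [cardI wI _]].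
(* Since [t < n], a set justifying [c] is nonempty, so [c] is actually reported. *)
have /card_gt0P[i /wI] : 0 < #|I| by rewrite (leq_trans _ cardI) ?subn_gt0.
exact: w_b.
Qed.

Theorem theorem5p4 (n t : nat) (V : Type) (v0 : V) (ht : 2 * t < n) :
  solves t (sm_protocol n t v0) (@byzantine_SM n V t).
Proof.
move=> x corrupted d [few honest auth].
have lt_tn : t < n by rewrite (leq_ltn_trans _ ht) // mul2n -addnn leq_addr.
have cardC r : r < 2 -> n - t <= #|~: corrupted r|.
  by move=> /few le_t; rewrite cardsCs setCK card_ord leq_sub2l.
pose v i := [ffun k => received_value v0 (d 0 k i)].
(* By computation, [i] enters round 1 in state [Values (v i)], even if it was corrupted in round
   0. *)
have relay i j : i \notin corrupted 1 -> d 1 i j = Some (encode (v i)).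
  exact: honest.
pose w i j l := received_vector (d 1 i j) l.
have w_honest i j l : i \notin corrupted 1 -> w i j l = Some (v i l).
  by move=> /relay Ei; rewrite /w Ei received_vector_encode.
have outE j l : output j (state_at (sm_protocol n t v0) x d 2 j) l =
    decide t (fun i => w i j l).
  by rewrite /= ffunE.
split.
- exists (~: corrupted 0); split; first exact: cardC.
  move=> l; rewrite inE => l_honest j; rewrite outE.
  have sent k : d 0 l k = Some (Val (x l)) by exact: honest.
  apply: (decide_unanimous _ _ _ _ _ (~: corrupted 1)) => //; first exact: cardC.
    by move=> i; rewrite inE => /w_honest->; rewrite ffunE sent.
  move=> i c /received_vectorP[u du <-].
  (* As [l] is uncorrupted in round 0, the entry [u l] must have been sent by [l] to some [k], and
     [l] sent only [x l]. *)
  have [|[_ [k]]] := auth 1 i j _ isT du l 0 _ isT (substring_encode _ _ u l).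
    by rewrite (negPf l_honest).
  by rewrite sent => -[].
- move=> i j l; rewrite !outE.
  have /card_gt0P[k] : 0 < #|~: corrupted 1|.
    by rewrite (leq_trans _ (cardC 1 isT)) ?subn_gt0.
  rewrite inE => k_honest.
  case Ei: decide => [b|] // _; case Ej: decide => [c|] // _.
  (* Both [b] and [c] equal [v k l], which does not depend on the recipient. *)
  have := decideP _ _ _ _ _ k Ei; have := decideP _ _ _ _ _ k Ej.
  by rewrite !w_honest // => <- // <-.
Qed.
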